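(* Let $R$ be a reduced coherent ring. Then, for any prime ideal $P$ of $R$, $P$ is finitely generated if $P^n$ is finitely generated for some integer $n>0$.
   Context: All rings are commutative with identity. A ring is coherent if each of its finitely generated ideals is finitely presented. *)

(* Defs.v *)
From HB Require Import structures.
From mathcomp Require Import all_boot all_order all_algebra ring_quotient.
From mathcomp Require Import boolp classical_sets.

Set Implicit Arguments.
Unset Strict Implicit.
Unset Printing Implicit Defensive.

Import GRing.Theory.
Local Open Scope classical_set_scope.
Local Open Scope ring_scope.

(* Submodules and ideals are [Prop]-valued sets, with no decidability
   assumption; [mem M] is the boolean predicate [x \in M] to which the
   closure properties of the library apply. *)

Section Modules.
Context {R : comNzRingType} {V : lmodType R}.

Definition submodule (M : set V) : Prop := submod_closed (mem M).

Definition span (S : set V) : set V := smallest submodule S.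

Definition finitely_generated (M : set V) : Prop :=
  exists s : seq V, M = span [set` s].

End Modules.

(* An exact sequence 0 -> K -> R^n -> M -> 0 with K finitely generated. *)
Definition finitely_presented {R : comNzRingType} {V : lmodType R}
    (M : set V) : Prop :=
  exists (n : nat) (phi : {linear 'rV[R]_n -> V}),
    range phi = M /\ finitely_generated (phi @^-1` [set 0]).

Section Rings.
Context {R : comNzRingType}.

(* Ideals are the submodules of the regular module [R^o]. [idealr_closed]
   cannot be used here: it also requires the ideal to be proper. *)
Definition ideal (I : set R) : Prop := @submodule R R^o I.

Definition fg_ideal (I : set R) : Prop := @finitely_generated R R^o I.

Definition fp_ideal (I : set R) : Prop := @finitely_presented R R^o I.

(* [idealr_closed] includes [1 \notin P]. *)
Definition prime_ideal (P : set R) : Prop :=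
  idealr_closed (mem P) /\ prime_idealr_closed (mem P).

Definition ideal_mul (I J : set R) : set R :=
  @span R R^o [set x * y | x in I & y in J].

Definition ideal_exp (I : set R) (n : nat) : set R :=
  iter n (ideal_mul I) setT.

End Rings.

Definition reduced (R : comNzRingType) : Prop :=
  forall (x : R) (n : nat), x ^+ n = 0 -> x = 0.

Definition coherent (R : comNzRingType) : Prop :=
  forall I : set R, ideal I -> fg_ideal I -> fp_ideal I.

(* Main.v *)
(** Let [P ^ n] be finitely generated, with [0 < n].  Expanding generators of
    [P ^ n] gives a finitely generated [J] inside [P] with [J ^ n = P ^ n].
    By coherence the colon ideal [Q = (P ^ n : J ^ (n - 1))] is finitely
    generated, and it contains [P].  If [Q = P] we are done.  Otherwise some
    [x] outside [P] satisfies [x J ^ (n - 1) <= J J ^ (n - 1)], and the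
    determinant trick yields [y] outside [P] that kills [J ^ (n - 1)], hence
    [P ^ n].  As [R] is reduced, [y] kills [P], so that [P] is the annihilator
    of [y], which is finitely generated by coherence. *)
Require Import Defs.
From mathcomp Require Import all_boot all_order all_algebra.
From mathcomp Require Import boolp classical_sets.

Set Implicit Arguments.
Unset Strict Implicit.
Unset Printing Implicit Defensive.

Import GRing.Theory.
Local Open Scope classical_set_scope.
Local Open Scope ring_scope.

(* [vector] also defines a [span], of sequences in a [vectType]. *)
Local Notation span := Defs.span.

(** * Submodules and spans of finite sequences *)

Section Submodules.
Context {R : comNzRingType} {V : lmodType R}.
Implicit Types (M S : set V) (s : seq V).

Lemma submoduleP M :
  submodule M <-> M 0 /\ forall a u v, M u -> M v -> M (a *: u + v).
Proof.
split=> [[M0 Mlin]|[M0 Mlin]]; split.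
- exact: set_mem M0.
- by move=> a u v Mu Mv; apply: set_mem; apply: Mlin; apply: mem_set.
- exact: mem_set.
- by move=> a u v /set_mem Mu /set_mem Mv; apply: mem_set; apply: Mlin.
Qed.

Lemma submoduleD M u v : submodule M -> M u -> M v -> M (u + v).
Proof. by move=> /submoduleP[_ Ml] Mu Mv; rewrite -[u]scale1r; apply: Ml. Qed.

Lemma submoduleZ M a u : submodule M -> M u -> M (a *: u).
Proof.
by move=> /submoduleP[M0 Ml] Mu; rewrite -[a *: u]addr0; apply: Ml.
Qed.

Lemma submodule_sum M (I : Type) (r : seq I) (p : pred I) (F : I -> V) :
  submodule M -> (forall i, p i -> M (F i)) -> M (\sum_(i <- r | p i) F i).
Proof.
move=> hM MF; apply: (big_ind M) => //; first by case/submoduleP: hM.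
by move=> u v; apply: submoduleD.
Qed.

Lemma span_submodule S : submodule (span S).
Proof.
apply/submoduleP; split=> [M [/submoduleP[M0 _] _]//|a u v Su Sv M [hM SM]].
by case/submoduleP: (hM) => _; apply; [apply: Su|apply: Sv].
Qed.

Lemma sub_span S : S `<=` span S.
Proof. by move=> x Sx M [_]; apply. Qed.

Lemma span_min S M : submodule M -> S `<=` M -> span S `<=` M.
Proof. by move=> hM SM x; apply. Qed.

Lemma span_seqE s :
  span [set` s] = range (fun u : 'rV[R]_(size s) => \sum_i u 0 i *: s`_i).
Proof.
apply/seteqP; split.
- apply: span_min.
    apply/submoduleP; split.
      by exists 0 => //; apply: big1 => i _; rewrite mxE scale0r.
    move=> a _ _ [u _ <-] [v _ <-]; exists (a *: u + v) => //.
    rewrite scaler_sumr -big_split /=; apply: eq_bigr => i _.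
    by rewrite !mxE scalerDl scalerA.
  move=> x /= xs; have lt_xs : (index x s < size s)%N by rewrite index_mem.
  exists (delta_mx 0 (Ordinal lt_xs)) => //.
  rewrite (bigD1 (Ordinal lt_xs)) //= big1 ?addr0.
    by rewrite mxE !eqxx scale1r nth_index.
  by move=> i /negPf ne; rewrite mxE ne andbF scale0r.
- move=> _ [u _ <-]; apply: (submodule_sum _ (span_submodule [set` s])) => i _.
  apply: (submoduleZ _ (span_submodule [set` s])).
  by apply: sub_span; rewrite /= mem_nth.
Qed.

End Submodules.

(** * Finitely generated ideals in matrix form *)

Section ColumnIdeals.
Context {R : comNzRingType}.

(** The generators are stacked in a column, so that relations between them and changes of generators
    become matrix equations. *)
Definition col_ideal n (c : 'cV[R]_n) : set R :=
  range (fun u : 'rV_n => (u *m c) 0 0).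

Lemma fg_idealP (I : set R) :
  fg_ideal I <-> exists n (c : 'cV[R]_n), I = col_ideal c.
Proof.
split=> [[s ->]|[n [c ->]]].
  exists (size s), (\col_i s`_i); rewrite span_seqE /col_ideal.
  apply: eq_imagel => u _; rewrite mxE.
  by apply: eq_bigr => i _; rewrite !mxE.
exists (codom (fun i => c i 0)); apply/seteqP; split.
- move=> _ [u _ <-]; rewrite mxE.
  have hS := @span_submodule R R^o [set` codom (fun i => c i 0)].
  apply: (submodule_sum _ hS) => i _; apply: (submoduleZ _ hS).
  by apply: sub_span; apply: codom_f.
- apply: (@span_min R R^o) => [|x /= /codomP[i ->]].
    apply/(@submoduleP R R^o); split.
      by exists 0 => //; rewrite mul0mx mxE.
    move=> a _ _ [u _ <-] [v _ <-]; exists (a *: u + v) => //.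
    by rewrite mulmxDl -scalemxAl !mxE.
  by exists (delta_mx 0 i) => //; rewrite -rowE mxE.
Qed.

Lemma fg_rowsP n (M : set 'rV[R]_n) : finitely_generated M ->
  exists k (A : 'M[R]_(k, n)), M = range (fun w : 'rV_k => w *m A).
Proof.
case=> s ->; exists (size s), (\matrix_i s`_i); rewrite span_seqE.
apply: eq_imagel => u _; rewrite mulmx_sum_row.
by apply: eq_bigr => i _; rewrite rowK.
Qed.

Lemma col_ideal_is_ideal n (c : 'cV[R]_n) : ideal (col_ideal c).
Proof.
have [s ->] : fg_ideal (col_ideal c) by apply/fg_idealP; exists n, c.
exact: span_submodule.
Qed.

(** Coefficients are chosen for each entry of [A] and become the rows of [W]; this turns an
    inclusion of ideals into a matrix identity. *)
Lemma col_idealP n m (c : 'cV[R]_n) (A : 'cV[R]_m) :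
  (forall i, col_ideal c (A i 0)) -> exists W, A = W *m c.
Proof.
move=> hA.
have /choice[f hf] i : exists u : 'rV_n, (u *m c) 0 0 = A i 0.
  by have [u _ <-] := hA i; exists u.
exists (\matrix_i f i); apply/matrixP => i j.
by rewrite ord1 -hf !mxE; apply: eq_bigr => k _; rewrite mxE.
Qed.

End ColumnIdeals.

(** * Intersections, colons and annihilators over a coherent ring *)

Section Coherence.
Context {R : comNzRingType}.
Context (hcoh : coherent R).

(* Schanuel's argument, with matrices.  Let [d] be the generators of the ideal
   of [c] given by a finite presentation, whose relations are the rows of [K].
   If [c = V d] and [d = W c], then [u c = 0] iff [u V] is a combination of the
   rows of [K], and [u = u (1 - V W) + u V W]. *)
Lemma coherent_left_kernel n (c : 'cV[R]_n) :
  exists k (A : 'M[R]_(k, n)),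
    [set u : 'rV_n | u *m c = 0] = range (fun w : 'rV_k => w *m A).
Proof.
have fgc : fg_ideal (col_ideal c) by apply/fg_idealP; exists n, c.
have [m [phi [phi_c /fg_rowsP[k [K hK]]]]] := hcoh (col_ideal_is_ideal c) fgc.
pose d : 'cV[R]_m := \col_i phi (delta_mx 0 i).
have phiE v : phi v = (v *m d) 0 0.
  rewrite {1}[v]row_sum_delta linear_sum mxE; apply: eq_bigr => i _.
  by rewrite linearZ mxE.
have phi_d : range phi = col_ideal d.
  by apply: eq_imagel => v _; rewrite phiE.
have [V cV] : exists V, c = V *m d.
  apply: col_idealP => i; rewrite -phi_d phi_c.
  by exists (delta_mx 0 i) => //; rewrite -rowE mxE.
have [W dW] : exists W, d = W *m c.
  apply: col_idealP => i; rewrite -phi_c.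
  by exists (delta_mx 0 i) => //; rewrite mxE.
have kerd (v : 'rV_m) : v *m d = 0 <-> exists w, w *m K = v.
  have <- : (phi @^-1` [set 0]) v <-> exists w, w *m K = v.
    by rewrite hK; split=> [[w _ <-]|[w <-]]; exists w.
  rewrite /= phiE; split=> [->|v0]; first by rewrite mxE.
  by apply/matrixP => i j; rewrite !ord1 v0 mxE.
exists (n + k)%N, (col_mx (1%:M - V *m W) (K *m W)); apply/seteqP; split.
- move=> u /= uc0; have /kerd[w wK] : u *m V *m d = 0 by rewrite -mulmxA -cV.
  exists (row_mx u w) => //.
  by rewrite mul_row_col mulmxBr mulmx1 !mulmxA wK subrK.
- move=> _ [w _ <-] /=; rewrite -[w]hsubmxK mul_row_col mulmxDl -!mulmxA.
  rewrite mulmxBl mul1mx -mulmxA -dW -cV subrr mulmx0 add0r.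
  by rewrite mulmxA; apply/kerd; exists (rsubmx w).
Qed.

(** An equality [u g = v h] is a relation [(u, -v)] on [g] stacked over [h]. Hence the left halves
    of generating relations, multiplied by [g], generate the intersection. *)
Lemma coherent_fgI (I J : set R) :
  fg_ideal I -> fg_ideal J -> fg_ideal (I `&` J).
Proof.
move=> /fg_idealP[k [g ->]] /fg_idealP[l [h ->]].
have [r [A hA]] := coherent_left_kernel (col_mx g h).
apply/fg_idealP; exists r, (lsubmx A *m g); apply/seteqP; split.
- move=> _ [[u _ <-] [v _ huv]].
  have : [set u | u *m col_mx g h = 0] (row_mx u (- v)).
    rewrite /= mul_row_col mulNmx; apply/matrixP => i j; rewrite !ord1 !mxE.
    by move: huv; rewrite !mxE => ->; rewrite subrr.
  rewrite hA => -[w _ hw]; exists w => //.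
  by rewrite mulmxA mulmx_lsub hw row_mxKl.
- move=> _ [w _ <-]; split.
    by exists (w *m lsubmx A) => //; rewrite mulmxA.
  exists (- (w *m rsubmx A)) => //.
  have : [set u | u *m col_mx g h = 0] (w *m A) by rewrite hA; exists w.
  rewrite /= -{1}[A]hsubmxK mul_mx_row mul_row_col => /eqP.
  by rewrite addr_eq0 mulmxA mulNmx => /eqP ->.
Qed.

(** Here [x a = u g] is a relation [(-u, x)] on [g] stacked over [a], so the last coordinates of
    generating relations generate the colon ideal. *)
Lemma coherent_fg_colon1 (I : set R) (a : R) :
  fg_ideal I -> fg_ideal [set x | I (x * a)].
Proof.
move=> /fg_idealP[k [g ->]].
have [r [A hA]] := coherent_left_kernel (col_mx g (a%:M : 'M_1)).
apply/fg_idealP; exists r, (rsubmx A); apply/seteqP; split.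
- move=> x [u _ hu].
  have : [set u | u *m col_mx g a%:M = 0] (row_mx (- u) (x%:M : 'M_1)).
    rewrite /= mul_row_col mulNmx -scalar_mxM; apply/matrixP => i j.
    by rewrite !ord1 mxE [X in X + _]mxE hu mxE eqxx mulr1n addNr mxE.
  rewrite hA => -[w _ hw]; exists w => //.
  by rewrite mulmx_rsub hw row_mxKr mxE eqxx mulr1n.
- move=> _ [w _ <-] /=.
  have : [set u | u *m col_mx g a%:M = 0] (w *m A) by rewrite hA; exists w.
  rewrite /= -{1}[A]hsubmxK mul_mx_row mul_row_col => /eqP.
  rewrite addr_eq0 => /eqP e; exists (- (w *m lsubmx A)) => //.
  by rewrite mulNmx e opprK mul_mx_scalar mxE mulrC.
Qed.

Lemma fg_setT : fg_ideal [set: R].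
Proof.
apply/fg_idealP; exists 1%N, 1%:M; apply/seteqP; split=> // x _.
by exists x%:M => //; rewrite mulmx1 mxE eqxx mulr1n.
Qed.

(** For fixed [x], the [y] with [x y] in [I] form an ideal, so it suffices to test generators of
    [J]. The colon is thus a finite intersection of colons by single elements, starting from the
    unit ideal. *)
Lemma coherent_fg_colon (I J : set R) :
  fg_ideal I -> fg_ideal J ->
  fg_ideal [set x | forall y, J y -> I (x * y)].
Proof.
move=> fgI [s ->].
have hI : ideal I by case: fgI => t ->; apply: span_submodule.
have -> : [set x | forall y, @span R R^o [set` s] y -> I (x * y)] =
          [set x | forall y, y \in s -> I (x * y)].
  apply/seteqP; split=> x hx y ys; first by apply: hx; apply: sub_span.
  suff /(_ y ys) : @span R R^o [set` s] `<=` [set y | I (x * y)] by [].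
  apply: (@span_min R R^o) => //; case/(@submoduleP R R^o): (hI) => I0 Il.
  apply/(@submoduleP R R^o); split=> [|a u v /= Iu Iv].
    by rewrite /= mulr0.
  by rewrite mulrDr [x * _]mulrCA; apply: Il.
elim: s => [|a s IHs].
  suff -> : [set x | forall y : R, y \in [::] -> I (x * y)] = setT.
    exact: fg_setT.
  by apply/seteqP; split.
suff -> : [set x | forall y : R, y \in a :: s -> I (x * y)] =
    [set x | I (x * a)] `&` [set x | forall y : R, y \in s -> I (x * y)].
  by apply: coherent_fgI => //; apply: coherent_fg_colon1.
apply/seteqP; split=> x /=.
- by move=> hx; split=> [|y ys]; apply: hx; rewrite inE ?eqxx ?ys ?orbT.
- by move=> [xa hx] y; rewrite inE => /predU1P[->//|/hx].
Qed.

Lemma coherent_fg_ann (a : R) : fg_ideal [set x | x * a = 0].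
Proof.
suff fg0 : fg_ideal [set 0 : R] by apply: (coherent_fg_colon1 a fg0).
(* The zero ideal is the ideal of the empty column. *)
apply/fg_idealP; exists 0%N, 0; apply/seteqP; split=> [x ->|_ [u _ <-]] /=.
  by exists 0 => //; rewrite mulmx0 mxE.
by rewrite mulmx0 mxE.
Qed.

End Coherence.

(** * Products and powers of ideals *)

Section Powers.
Context {R : comNzRingType}.
Implicit Types (I J : set R) (s : seq R).

Local Notation ispan s := (@Defs.span R R^o [set` s]).

Lemma idealP I : ideal I <-> I 0 /\ forall a u v, I u -> I v -> I (a * u + v).
Proof. exact: (@submoduleP R R^o). Qed.

Lemma idealMl I a u : ideal I -> I u -> I (a * u).
Proof. exact: (@submoduleZ R R^o). Qed.

Lemma ideal_mul_ideal I J : ideal (ideal_mul I J).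
Proof. exact: span_submodule. Qed.

Lemma mem_ideal_mul I J x y : I x -> J y -> ideal_mul I J (x * y).
Proof. by move=> Ix Jy; apply: (@sub_span R R^o); exists x => //; exists y. Qed.

Lemma ideal_mul_min I J (K : set R) :
  ideal K -> (forall x y, I x -> J y -> K (x * y)) -> ideal_mul I J `<=` K.
Proof.
by move=> hK IJK; apply: (@span_min R R^o) => // _ [x Ix [y Jy <-]]; apply: IJK.
Qed.

Lemma ideal_exp_ideal I n : ideal (ideal_exp I n).
Proof. by case: n => [|n]; [apply/idealP|apply: ideal_mul_ideal]. Qed.

Lemma ideal_expS_sub I J n : I `<=` J -> ideal_exp I n `<=` ideal_exp J n.
Proof.
move=> IJ; elim: n => //= n IHn; apply: ideal_mul_min => [|x y /IJ Jx /IHn].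
  exact: ideal_mul_ideal.
exact: mem_ideal_mul.
Qed.

Lemma mem_ideal_exp I x n : I x -> ideal_exp I n (x ^+ n).
Proof.
by move=> Ix; elim: n => // n IHn; rewrite exprS; apply: mem_ideal_mul.
Qed.

(** With one factor fixed, the values of the other whose product lies in the right-hand side form an
    ideal; this reduces each factor in turn to generators. *)
Lemma ispan_mul s t :
  ideal_mul (ispan s) (ispan t) = ispan [seq x * y | x <- s, y <- t].
Proof.
set st := [seq _ | _ <- s, _ <- t].
have /idealP[S0 Sl] : ideal (ispan st) by apply: span_submodule.
apply/seteqP; split.
- apply: ideal_mul_min => [|x y xs yt]; first exact: span_submodule.
  suff /(_ x xs) : ispan s `<=` [set x | ispan st (x * y)] by [].
  apply: (@span_min R R^o) => [|{}x /= {}xs].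
    apply/idealP; split=> [|a u v /= Su Sv]; first by rewrite /= mul0r.
    by rewrite mulrDl -mulrA; apply: Sl.
  suff /(_ y yt) : ispan t `<=` [set y | ispan st (x * y)] by [].
  apply: (@span_min R R^o) => [|{}y /= {}yt].
    apply/idealP; split=> [|a u v /= Su Sv]; first by rewrite /= mulr0.
    by rewrite mulrDr [x * _]mulrCA; apply: Sl.
  by apply: (@sub_span R R^o); apply: allpairs_f.
- apply: (@span_min R R^o) => [|_ /= /allpairsP[[x y] /= [xs yt ->]]].
    exact: ideal_mul_ideal.
  by apply: mem_ideal_mul; apply: (@sub_span R R^o).
Qed.

Lemma fg_ideal_mul I J : fg_ideal I -> fg_ideal J -> fg_ideal (ideal_mul I J).
Proof. by move=> [s ->] [t ->]; eexists; exact: ispan_mul. Qed.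

Lemma fg_ideal_exp I n : fg_ideal I -> fg_ideal (ideal_exp I n).
Proof.
move=> fgI; elim: n => [|n IHn]; first exact: fg_setT.
exact: fg_ideal_mul.
Qed.

Lemma ispan_subl s t : ispan s `<=` ispan (s ++ t).
Proof.
apply: (@span_min R R^o) => [|x /= xs]; first exact: span_submodule.
by apply: (@sub_span R R^o); rewrite /= mem_cat xs.
Qed.

Lemma ispan_subr s t : ispan t `<=` ispan (s ++ t).
Proof.
apply: (@span_min R R^o) => [|x /= xt]; first exact: span_submodule.
by apply: (@sub_span R R^o); rewrite /= mem_cat xt orbT.
Qed.

Lemma cat_sub_set s t I :
  [set` s] `<=` I -> [set` t] `<=` I -> [set` s ++ t] `<=` I.
Proof.
by move=> sI tI x /=; rewrite mem_cat => /orP[/sI|/tI].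
Qed.

Lemma ideal_exp_fg_witness I n z :
  ideal_exp I n z ->
  exists2 s : seq R, [set` s] `<=` I & ideal_exp (ispan s) n z.
Proof.
elim: n z => [|n IHn] z; first by exists [::].
(* [K] collects the elements that have a witness. It is an ideal because two witnesses can be
   concatenated and powers are monotone. *)
pose K := [set z | exists2 s : seq R,
  [set` s] `<=` I & ideal_exp (ispan s) n.+1 z].
suff : ideal_exp I n.+1 `<=` K by apply.
apply: ideal_mul_min => [|x y Ix /IHn[s sI yn]].
  apply/idealP; split.
    by exists [::] => //; case/idealP: (ideal_exp_ideal (ispan [::]) n.+1).
  move=> a u v [s sI us] [t tI vt]; exists (s ++ t); first exact: cat_sub_set.
  have /idealP[_] := ideal_exp_ideal (ispan (s ++ t)) n.+1; apply.
    exact: ideal_expS_sub (@ispan_subl s t) _ us.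
  exact: ideal_expS_sub (@ispan_subr s t) _ vt.
exists (x :: s) => [w /=|]; first by rewrite inE => /predU1P[->//|/sI].
apply: mem_ideal_mul; first by apply: (@sub_span R R^o); rewrite /= mem_head.
exact: ideal_expS_sub (@ispan_subr [:: x] s) _ yn.
Qed.

(** The witnesses of the finitely many generators of the power are concatenated into one
    sequence. *)
Lemma ideal_exp_fg_reduction I n : fg_ideal (ideal_exp I n) ->
  exists2 s : seq R, [set` s] `<=` I & ideal_exp I n `<=` ideal_exp (ispan s) n.
Proof.
case=> t ht.
have tI : [set` t] `<=` ideal_exp I n by rewrite ht; apply: sub_span.
suff [s sI ts] :
    exists2 s : seq R, [set` s] `<=` I & [set` t] `<=` ideal_exp (ispan s) n.
  exists s => //; rewrite ht; apply: (@span_min R R^o) => //.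
  exact: ideal_exp_ideal.
elim: t tI {ht} => [|z t IHt] tI; first by exists [::].
have [|s sI ts] := IHt.
  by move=> x /= xt; apply: tI; rewrite /= inE xt orbT.
have [|r rI zr] := @ideal_exp_fg_witness I n z.
  by apply: tI; rewrite /= mem_head.
exists (r ++ s); first exact: cat_sub_set.
move=> x /=; rewrite inE => /predU1P[->|xt].
  exact: ideal_expS_sub (@ispan_subl r s) _ zr.
exact: ideal_expS_sub (@ispan_subr r s) _ (ts _ xt).
Qed.

End Powers.

(** * The determinant trick *)

Section DeterminantTrick.
Context {R : comNzRingType}.

(** In the Leibniz expansion, congruence modulo [I] passes through products and sums. *)
Lemma det_congr (I : set R) m (A B : 'M[R]_m) : ideal I ->
  (forall i j, I (A i j - B i j)) -> I (\det A - \det B).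
Proof.
move=> hI AB; rewrite -sumrB; apply: (submodule_sum _ hI) => s _.
rewrite -mulrBr; apply: idealMl => //.
apply: (big_ind2 (fun x y => I (x - y))) => //.
  by rewrite subrr; case/idealP: hI.
move=> a b c d Iab Icd.
have -> : a * c - b * d = c * (a - b) + b * (c - d).
  by rewrite !mulrBr [c * a]mulrC [c * b]mulrC addrA subrK.
apply: (@submoduleD R R^o) => //; exact: idealMl.
Qed.

(** The coefficients on the generators of the second factor can be taken in [J]; this puts the
    matrix of the determinant trick in [J]. *)
Lemma col_ideal_mulP (J : set R) m (a : 'cV[R]_m) (x : R) : ideal J ->
  ideal_mul J (col_ideal a) x ->
  exists2 b : 'rV_m, forall j, J (b 0 j) & x = (b *m a) 0 0.
Proof.
move=> hJ; case/idealP: (hJ) => J0 Jl; move: x.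
apply: ideal_mul_min => [|x _ Jx [u _ <-]].
  apply/idealP; split; first by exists 0 => [j|]; rewrite ?mul0mx mxE.
  move=> c _ _ [u Ju ->] [v Jv ->]; exists (c *: u + v) => [j|].
    by rewrite !mxE; apply: Jl.
  by rewrite mulmxDl -scalemxAl !mxE.
exists (x *: u) => [j|]; last by rewrite -scalemxAl [RHS]mxE.
by rewrite mxE mulrC; apply: idealMl.
Qed.

(** On generators [a] of [K], multiplication by [x] is a matrix [B] over [J]. Then [y = det (x - B)]
    is congruent to [x ^ m] modulo [J], and the adjugate shows that it kills [a]. *)
Lemma determinant_trick (J K : set R) (x : R) : ideal J -> fg_ideal K ->
  (forall y, K y -> ideal_mul J K (x * y)) ->
  exists m y, J (y - x ^+ m) /\ forall z, K z -> y * z = 0.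
Proof.
move=> hJ /fg_idealP[m [a ->]] xK.
have /choice[f hf] i : exists b : 'rV_m,
    (forall j, J (b 0 j)) /\ x * a i 0 = (b *m a) 0 0.
  have [|b Jb xb] := @col_ideal_mulP J m a (x * a i 0) hJ; last by exists b.
  by apply: xK; exists (delta_mx 0 i) => //; rewrite -rowE mxE.
pose B : 'M[R]_m := \matrix_i f i.
exists m, (\det (x%:M - B)); split.
  rewrite -(det_scalar m x); apply: det_congr => // i j.
  have [/(_ j) Jf _] := hf i; rewrite !mxE addrAC subrr add0r -mulN1r.
  exact: idealMl.
have Ba : (x%:M - B) *m a = 0.
  apply/matrixP => i j; rewrite ord1 mulmxBl mul_scalar_mx !mxE.
  have [_ ->] := hf i; rewrite mxE -sumrB big1 // => k _.
  by rewrite mxE subrr.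
move=> _ [u _ <-].
have : \adj (x%:M - B) *m (x%:M - B) *m a = 0 by rewrite -mulmxA Ba mulmx0.
rewrite mul_adj_mx mul_scalar_mx => da.
have -> : \det (x%:M - B) * (u *m a) 0 0 = (u *m (\det (x%:M - B) *: a)) 0 0.
  by rewrite -scalemxAr [RHS]mxE.
by rewrite da mulmx0 mxE.
Qed.

End DeterminantTrick.

(** * Prime ideals and the final argument *)

Section Prime.
Context {R : comNzRingType} (P : set R) (hP : prime_ideal P).

Lemma prime_ideal_ideal : ideal P.
Proof.
case: hP => -[P0 _ Pl] _; apply/idealP; split; first exact: set_mem.
by move=> a u v Pu Pv; apply: set_mem; apply: Pl; apply: mem_set.
Qed.

Lemma prime_idealM u v : P (u * v) -> P u \/ P v.
Proof.
case: hP => _ Pp /(@mem_set _ P) /Pp /orP[] /set_mem; by [left|right].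
Qed.

Lemma prime_idealX x n : P (x ^+ n) -> P x.
Proof.
elim: n => [|n IHn]; last by rewrite exprS => /prime_idealM[|/IHn].
(* Exponent 0: [1] would lie in [P], which is proper. *)
by case: hP => -[_ /negP P1 _] _ /(@mem_set _ P).
Qed.

End Prime.

Theorem corollary3p4 (R : comNzRingType) (hred : reduced R) (hcoh : coherent R)
  (P : set R) (hP : prime_ideal P) (n : nat) (hn : (0 < n)%N)
  (hfg : fg_ideal (ideal_exp P n)) : fg_ideal P.
Proof.
(* From here on the exponent is [n.+1], and [n] may be 0. *)
case: n hn hfg => // n _ fgPn; have idP := prime_ideal_ideal hP.
have [s sP Pn_sub] := ideal_exp_fg_reduction fgPn.
pose J := @Defs.span R R^o [set` s].
have JP : J `<=` P by apply: (@span_min R R^o).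
have fgJ : fg_ideal (ideal_exp J n) by apply: fg_ideal_exp; exists s.
have fgQ := coherent_fg_colon hcoh fgPn fgJ; set Q := mkset _ in fgQ.
have PQ : P `<=` Q.
  move=> x Px y /(ideal_expS_sub JP) Pny; exact: mem_ideal_mul.
have [QP|] := pselect (Q `<=` P).
  by have -> : P = Q by apply/seteqP.
move=> /existsNP[x /not_implyP[Qx nPx]].
(* The trick applies because [x J ^ n] lies in [P ^ n.+1], hence in [J ^ n.+1], which unfolds to [J]
   times [J ^ n]. *)
have [|y Jny|m [y [Jy y0]]] := @determinant_trick R J (ideal_exp J n) x _ fgJ.
- exact: span_submodule.
- exact: Pn_sub (Qx _ Jny).
(* Since [y] and [x ^ m] agree modulo [J], hence modulo [P], having [y] in [P] would force [x] into
   [P]. *)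
have nPy : ~ P y.
  move=> Py; apply: nPx; apply: (@prime_idealX _ _ hP x m).
  rewrite -[x ^+ m](subKr y) -mulN1r addrC.
  by case/idealP: idP => _; apply=> //; apply: JP.
have yP p : P p -> p * y = 0.
  (* The power [(p y) ^ n.+1] has the factor [y p ^ n.+1]. It vanishes because [p ^ n.+1] lies in
     [J ^ n.+1], which [y] kills along with [J ^ n]. *)
  move=> Pp; apply: (hred _ n.+1); rewrite exprMn exprS [y ^+ _]exprSr mulrA.
  suff -> : p * p ^+ n * y ^+ n * y = y ^+ n * (y * p ^+ n.+1).
    have /Pn_sub : ideal_exp P n.+1 (p ^+ n.+1) by apply: mem_ideal_exp.
    move=> Jp; suff : ideal_exp J n.+1 `<=` [set z | y * z = 0].
      by move=> /(_ _ Jp) /= ->; rewrite mulr0.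
    apply: ideal_mul_min => [|u v _ /y0 yv]; last by rewrite /= mulrCA yv mulr0.
    apply/idealP; split=> [|a u v /= yu yv]; first by rewrite /= mulr0.
    by rewrite mulrDr mulrCA yu yv mulr0 addr0.
  by rewrite -exprS -mulrA [LHS]mulrC -mulrA.
suff -> : P = [set x | x * y = 0] by apply: coherent_fg_ann.
apply/seteqP; split=> z /=; first exact: yP.
(* Conversely, [z y = 0] lies in [P] while [y] does not, so primality gives [z] in [P]. *)
move=> zy; have Pzy : P (z * y) by rewrite zy; case/idealP: idP.
by have [] := prime_idealM hP Pzy.
Qed.
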